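(* Let $n\ge 2$. The transform $x\mapsto\mathcal{T}x$ of an arbitrary vector $x\in\mathbb{C}^n$ can be computed using $2n-2$ multiplications and $2n-2$ additions. Likewise, the Fourier transform $x\mapsto\mathcal{F}x$ on $I_n=\{1,\ldots,n\}$ (viewed as the homogeneous space $S_n/S_n^n$) of an arbitrary vector $x\in\mathbb{C}^n$ can be computed using $2n-2$ multiplications and $2n-2$ additions.
   Context: Operation counts: a computation is a finite sequence of arithmetic steps starting from the entries $x(1),\ldots,x(n)$; a multiplication multiplies an already available number by a fixed constant depending only on $n$ (not on $x$), and an addition adds or subtracts two already available numbers. Constants depending only on $n$ are precomputed and not counted. $S_n$ is the symmetric group on $I_n=\{1,\ldots,n\}$, with product given by composition, $(\sigma\delta)(i)=\sigma(\delta(i))$; $S_n^n$ is the subgroup fixing $n$. $\mathcal{I}_m$ denotes the $m\times m$ identity matrix, ${}^t$ denotes transpose, and $\oplus$ denotes the block-diagonal direct sum of matrices. The representation $D_\phi$, $\phi=(n-1,1)$: let $\tau_k=(k,k+1)$, $1\le k\le n-1$, be the adjacent transpositions. $D_\phi$ is the Young orthogonal representation for the partition $\phi=(n-1,1)$, i.e. the group homomorphism from $S_n$ to the real orthogonal $(n-1)\times(n-1)$ matrices determined by its values on the generators $\tau_k$: $D_\phi(\tau_1)=\mathrm{diag}[1,1,\ldots,1,-1]$, and for $k=2,\ldots,n-1$, $$D_\phi(\tau_k)=\mathcal{I}_{n-k-1}\oplus R_k\oplus \mathcal{I}_{k-2},\qquad R_k=\begin{pmatrix}-\frac1k&\sqrt{1-\frac1{k^2}}\\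 \sqrt{1-\frac1{k^2}}&\frac1k\end{pmatrix}.$$ (These matrices satisfy the Coxeter relations, so the homomorphism exists; the representation is irreducible.) Also $D_{(n)}(\sigma)=1$ for all $\sigma\in S_n$. The Fourier transform $\mathcal{F}$: for a complex vector $x=(x(1),\ldots,x(n))^t$, define $\widetilde{x}:S_n\to\mathbb{C}$ by $\widetilde{x}(\sigma)=x(\sigma(n))$ and, for $\nu\in\{(n),\phi\}$, $\widetilde{X}(\nu)=\sum_{\sigma\in S_n}\widetilde{x}(\sigma)D_\nu(\sigma)$. $\mathcal{F}$ is the linear map $\mathbb{C}^n\to\mathbb{C}^n$ sending $x$ to the column vector $$\mathcal{F}x=\left(\widetilde{X}((n)),\ \widetilde{X}(\phi)_{1,1},\ \widetilde{X}(\phi)_{2,1},\ \ldots,\ \widetilde{X}(\phi)_{n-1,1}\right)^t .$$ The matrix $\mathcal{T}$: let $U$ be the $n\times n$ matrix whose first row consists entirely of $1$'s, and whose $m$-th row, for $2\le m\le n$, has entries $-1$ in columns $1,\ldots,n-m+1$, entry $n-m+1$ in column $n-m+2$, and $0$ in all later columns (so row $2$ is $(-1,\ldots,-1,n-1)$ and row $n$ is $(-1,1,0,\ldots,0)$). Let $A=(UU^t)^{-1/2}$, which is the diagonal matrix with $A_{1,1}=1/\sqrt n$ and $A_{k,k}=1/\sqrt{(n-k+1)(n-k+2)}$ for $k>1$. Set $\mathcal{T}=AU$. *)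

(* Defs.v *)
From HB Require Import structures.
From mathcomp Require Import all_boot all_order all_algebra all_fingroup.
From mathcomp Require Import ring lra zify.
From mathcomp Require Import reals.
From mathcomp.real_closed Require Import complex.

Set Implicit Arguments.
Unset Strict Implicit.
Unset Printing Implicit Defensive.

Import Order.TTheory GRing.Theory Num.Theory.
Local Open Scope ring_scope.

(* One arithmetic step. Available numbers are referred to by their position
   in the list of all numbers obtained so far (inputs first). The scalars [c]
   are part of the program text, hence cannot depend on the input vector. *)
Inductive step (C : Type) : Type :=
| Mul of C & nat
| Add of nat & nat
| Sub of nat & nat.

Section Computation.
Variable C : nzRingType.
Implicit Types (s : step C) (p : seq (step C)) (v : seq C).

Definition is_mul s := if s is Mul _ _ then true else false.
Definition is_add s := ~~ is_mul s.

Definition step_ok m s :=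
  match s with
  | Mul _ i => (i < m)%N
  | Add i j | Sub i j => (i < m)%N && (j < m)%N
  end.

Definition step_val v s : C :=
  match s with
  | Mul c i => c * v`_i
  | Add i j => v`_i + v`_j
  | Sub i j => v`_i - v`_j
  end.

(* [m] is the number of values available before the first step of [p]. *)
Fixpoint prog_ok m p :=
  if p is s :: p' then step_ok m s && prog_ok m.+1 p' else true.

Definition run v p : seq C := foldl (fun w s => rcons w (step_val w s)) v p.

(* A single program, valid for all inputs, whose [i]-th output is the available
   number at position [out i]. *)
Definition computable_with n (f : 'cV[C]_n -> 'cV[C]_n) (muls adds : nat) :=
  exists (p : seq (step C)) (out : 'I_n -> nat),
    [/\ prog_ok n p,
        forall i, (out i < n + size p)%N,
        count is_mul p = muls,
        count is_add p = adds
      & forall (x : 'cV[C]_n) (i : 'I_n),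
          (run [seq x j 0 | j <- enum 'I_n] p)`_(out i) = f x i 0].

End Computation.

(* All indices below start at 0: the point i of I_n is the ordinal i.-1 and
   row m of U is row m.-1 here. *)
Definition Umx (R : realType) n : 'M[R]_n :=
  \matrix_(i < n, j < n)
    if i == 0%N :> nat then 1
    else if (j < n - i)%N then -1
    else if j == (n - i)%N :> nat then (n - i)%:R
    else 0.

Definition Amx (R : realType) n : 'M[R]_n :=
  diag_mx (\row_(i < n)
    if i == 0%N :> nat then (Num.sqrt n%:R)^-1
    else (Num.sqrt ((n - i) * (n - i).+1)%:R)^-1).

Definition Tmx (R : realType) n : 'M[R]_n := Amx R n *m Umx R n.

(* The image of tau_k, for 1 <= k <= n - 1. For k >= 2 this is the block sum
   I_(n-k-1) (+) R_k (+) I_(k-2), so R_k sits in rows and columns n-k-1, n-k. *)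
Definition young_gen (R : realType) n k : 'M[R]_n.-1 :=
  if k == 1%N then
    diag_mx (\row_(i < n.-1) if i == n.-2 :> nat then -1 else 1)
  else
    let a := (n - k.+1)%N in
    \matrix_(i < n.-1, j < n.-1)
      if (i == a :> nat) && (j == a :> nat) then - k%:R^-1
      else if (i == a.+1 :> nat) && (j == a.+1 :> nat) then k%:R^-1
      else if (i == a :> nat) && (j == a.+1 :> nat)
           || (i == a.+1 :> nat) && (j == a :> nat)
        then Num.sqrt (1 - (k%:R ^+ 2)^-1)
      else (i == j)%:R.

(* The product of S_n is composition, (s d)(i) = s (d i), whereas in perm.v
   [(d * s)%g i = s (d i)]; hence the order of the factors below. The
   transposition of the ordinals i and j = i + 1 is tau_j. *)
Definition is_Dphi (R : realType) n (D : 'S_n -> 'M[R]_n.-1) : Prop :=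
  [/\ forall s d : 'S_n, D (d * s)%g = D s *m D d,
      forall s : 'S_n, (D s)^T *m D s = 1%:M
    & forall i j : 'I_n, j = i.+1 :> nat -> D (tperm i j) = young_gen R n j].

Definition Dtriv (R : realType) n : 'S_n -> 'M[R]_1 := fun=> 1%:M.

Fact last_pt_subproof n : (1 < n)%N -> (n.-1 < n)%N.
Proof. by case: n. Qed.

Definition last_pt n (hn : (1 < n)%N) : 'I_n := Ordinal (last_pt_subproof hn).

Fact first_col_subproof n : (1 < n)%N -> (0 < n.-1)%N.
Proof. by case: n => [|[]]. Qed.

Definition first_col n (hn : (1 < n)%N) : 'I_n.-1 :=
  Ordinal (first_col_subproof hn).

Fact add1_pred n : (1 < n)%N -> (1 + n.-1 = n)%N.
Proof. by case: n. Qed.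

Definition ftransform (R : realType) n (hn : (1 < n)%N) d
    (D : 'S_n -> 'M[R]_d) (x : 'cV[R[i]]_n) : 'M[R[i]]_d :=
  \sum_(s : 'S_n) x (s (last_pt hn)) 0 *: map_mx (real_complex R) (D s).

Definition fourier (R : realType) n (hn : (1 < n)%N)
    (D : 'S_n -> 'M[R]_n.-1) (x : 'cV[R[i]]_n) : 'cV[R[i]]_n :=
  castmx (add1_pred hn, erefl 1%N)
    (col_mx (ftransform hn (@Dtriv R n) x)
            (col (first_col hn) (ftransform hn D x))).

Section Existence.
Variable R : realType.

(* Row of U indexed by b = n - i, before and after normalization. *)
Let u b j : R := if (j < b)%N then -1 else if j == b then b%:R else 0.
Let t b j : R := (Num.sqrt (b * b.+1)%:R)^-1 * u b j.

Let sum_const n b (c : R) : (b <= n)%N ->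
  \sum_(j < n) (if (j < b)%N then c else 0) = b%:R * c.
Proof.
move=> bn; rewrite -big_mkcond /=.
by rewrite -(big_ord_widen n (fun=> c) bn) sumr_const card_ord mulr_natl.
Qed.

Let sum_u n b : (b < n)%N -> \sum_(j < n) u b j = 0.
Proof.
move=> bn; have h (j : 'I_n) : u b j =
    (if (j < b)%N then -1 else 0) + (if j == Ordinal bn then b%:R else 0).
  rewrite /u -val_eqE /=; case: (ltngtP (val j) b) => _; rewrite ?addr0 ?add0r //.
under eq_bigr do rewrite h.
rewrite big_split /= sum_const 1?ltnW // -big_mkcond big_pred1_eq.
by rewrite mulrN1 addNr.
Qed.

Let sum_uu n b : (b < n)%N -> \sum_(j < n) u b j * u b j = (b * b.+1)%:R.
Proof.
move=> bn; have h (j : 'I_n) : u b j * u b j =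
    (if (j < b)%N then 1 else 0) + (if j == Ordinal bn then b%:R * b%:R else 0).
  rewrite /u -val_eqE /=; case: (ltngtP (val j) b) => _; rewrite ?addr0 ?add0r ?mulr0 //.
  by rewrite mulrNN mulr1.
under eq_bigr do rewrite h.
rewrite big_split /= sum_const 1?ltnW // -big_mkcond big_pred1_eq.
by rewrite natrM -[b.+1%:R]natr1; ring.
Qed.

Let sum_ult n b c : (b < c)%N -> (c < n)%N -> \sum_(j < n) u b j * u c j = 0.
Proof.
move=> bc cn; have h (j : 'I_n) : u b j * u c j = - u b j.
  rewrite /u; case: (ltngtP (val j) b) => jb; rewrite ?mul0r ?oppr0 //.
    by rewrite (ltn_trans jb bc); ring.
  by rewrite jb bc mulrN1.
by under eq_bigr do rewrite h; rewrite sumrN sum_u ?oppr0 //; apply: ltn_trans cn.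
Qed.

Let nrm b : (0 < b)%N ->
  (Num.sqrt (b * b.+1)%:R)^-1 * (Num.sqrt (b * b.+1)%:R)^-1 * (b * b.+1)%:R = 1 :> R.
Proof.
move=> b0; rewrite -invfM -expr2 sqr_sqrtr ?ler0n // mulVf //.
by rewrite pnatr_eq0 muln_eq0; case: b b0.
Qed.

Let sum_tt n b c : (0 < b < n)%N -> (0 < c < n)%N ->
  \sum_(j < n) t b j * t c j = (b == c)%:R.
Proof.
move=> /andP[b0 bn] /andP[c0 cn].
have -> : \sum_(j < n) t b j * t c j = (Num.sqrt (b * b.+1)%:R)^-1 *
    (Num.sqrt (c * c.+1)%:R)^-1 * \sum_(j < n) u b j * u c j.
  by rewrite mulr_sumr; apply: eq_bigr => j _; rewrite /t; ring.
case: (ltngtP b c) => [bc|cb|<-]; last by rewrite sum_uu // nrm.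
- by rewrite sum_ult // mulr0.
- by under eq_bigr do rewrite mulrC; rewrite sum_ult // mulr0.
Qed.

Let sum_t n b : (b < n)%N -> \sum_(j < n) t b j = 0.
Proof. by move=> bn; rewrite -mulr_sumr sum_u // mulr0. Qed.

Let TmxE n (i j : 'I_n) : Tmx R n i j =
  if i == 0%N :> nat then (Num.sqrt n%:R)^-1 else t (n - i) j.
Proof.
rewrite /Tmx /Amx mul_diag_mx !mxE; case: ifP => // _; by rewrite mulr1.
Qed.

Lemma Tmx_orthogonal n : Tmx R n *m (Tmx R n)^T = 1%:M.
Proof.
apply/matrixP => i k; rewrite mxE [RHS]mxE.
under eq_bigr do rewrite [_^T _ _]mxE !TmxE.
have [i0|i0] := eqVneq (i : nat) 0%N; have [k0|k0] := eqVneq (k : nat) 0%N.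
- have -> : (i == k) by rewrite -val_eqE /= i0 k0.
  rewrite sumr_const card_ord -[LHS]mulr_natr -invfM -expr2 sqr_sqrtr ?ler0n //.
  by rewrite mulVf // pnatr_eq0; case: n i {k i0 k0} => [[]|].
- rewrite -mulr_sumr sum_t ?mulr0; last by have := ltn_ord k; lia.
  suff -> : (i == k) = false by []. by rewrite -val_eqE /= i0 eq_sym; apply/negbTE.
- rewrite -mulr_suml sum_t ?mul0r; last by have := ltn_ord i; lia.
  suff -> : (i == k) = false by []. by rewrite -val_eqE /= k0; apply/negbTE.
- rewrite sum_tt; try by [have := ltn_ord i; have := ltn_ord k; lia].
  by rewrite -val_eqE /=; congr (_%:R); have := ltn_ord i; have := ltn_ord k; lia.
Qed.

(* A is the inverse square root of U U^t. *)
Lemma Amx_invsqrt n : Amx R n *m Amx R n *m (Umx R n *m (Umx R n)^T) = 1%:M.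
Proof.
have h : Amx R n *m (Umx R n *m (Umx R n)^T *m Amx R n) = 1%:M.
  rewrite -Tmx_orthogonal /Tmx trmx_mul !mulmxA.
  by congr (_ *m _); rewrite /Amx tr_diag_mx.
by apply: mulmx1C; rewrite mulmxA; apply: mulmx1C.
Qed.

Let sum_tt_row n (j k : 'I_n.+2) :
  \sum_(a < n.+1) t (n.+1 - a) j * t (n.+1 - a) k = (j == k)%:R - n.+2%:R^-1.
Proof.
have /matrixP/(_ j k) := mulmx1C (Tmx_orthogonal n.+2).
rewrite mxE [RHS]mxE; under eq_bigr do rewrite [_^T _ _]mxE !TmxE.
rewrite big_ord_recl /= -invfM -expr2 sqr_sqrtr ?ler0n // => <-.
rewrite [RHS]addrAC subrr add0r; apply: eq_bigr => a _; by rewrite /bump /= add1n subSS.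
Qed.

Let E n (s : 'S_n.+2) : 'M[R]_n.+1 := \matrix_(a, b)
  \sum_(j < n.+2) t (n.+1 - a) (s j) * t (n.+1 - b) j.

Let EM n (s d : 'S_n.+2) : E (d * s)%g = E s *m E d.
Proof.
apply/matrixP => a b; rewrite !mxE.
transitivity (\sum_(c < n.+1) \sum_(j < n.+2) \sum_(k < n.+2)
   (t (n.+1 - a) (s j) * t (n.+1 - b) k) * (t (n.+1 - c) j * t (n.+1 - c) (d k))); last first.
  apply: eq_bigr => c _; rewrite !mxE mulr_suml; apply: eq_bigr => j _.
  by rewrite mulr_sumr; apply: eq_bigr => k _; ring.
rewrite [RHS]exchange_big /=; under [RHS]eq_bigr do rewrite exchange_big /=.
rewrite [RHS]exchange_big /=; apply: eq_bigr => k _.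
under [RHS]eq_bigr do rewrite -mulr_sumr sum_tt_row.
transitivity (\sum_j t (n.+1 - a) (s j) * t (n.+1 - b) k * (j == d k)%:R
    - \sum_j t (n.+1 - a) (s j) * t (n.+1 - b) k * n.+2%:R^-1); last first.
  by rewrite -sumrB; apply: eq_bigr => j _; rewrite mulrBr.
rewrite -!mulr_suml -(reindex_inj (@perm_inj _ s) (P := predT) (F := fun j : 'I__ => t (n.+1 - a) j)) /=.
rewrite sum_t ?mul0r ?subr0; last by lia.
rewrite (bigD1 (d k)) //= eqxx mulr1 permM big1 ?addr0 // => j /negbTE->.
by rewrite mulr0.
Qed.

Let E_tr n (s : 'S_n.+2) : (E s)^T = E s^-1%g.
Proof.
apply/matrixP => a b; rewrite !mxE (reindex_inj (@perm_inj _ s^-1%g)) /=.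
by apply: eq_bigr => j _; rewrite permKV mulrC.
Qed.

Let E1 n : E (1%g : 'S_n.+2) = 1%:M.
Proof.
apply/matrixP => a b; rewrite !mxE; under eq_bigr do rewrite perm1.
have := ltn_ord a; have := ltn_ord b => ha hb.
rewrite sum_tt; [|lia|lia].
by congr (_%:R); rewrite -val_eqE /=; lia.
Qed.

Let ratio k : (0 < k)%N ->
  (Num.sqrt (k.+1 * k.+2)%:R)^-1 * (k.+2%:R / k.+1%:R)
   = Num.sqrt (1 - (k.+1%:R ^+ 2)^-1) * (Num.sqrt (k * k.+1)%:R)^-1 :> R.
Proof.
move=> k0; have kR : 0 < k%:R :> R by rewrite ltr0n.
have k1 : k%:R + 1 != 0 :> R by lra.
have k2 : k%:R + 1 + 1 != 0 :> R by lra.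
have kn : k%:R != 0 :> R by lra.
rewrite !natrM -[k.+2%:R]natr1 -[k.+1%:R]natr1.
have H1 : 0 <= (k%:R + 1) * (k%:R + 1 + 1) :> R by nra.
have H2 : 0 <= k%:R * (k%:R + 1) :> R by nra.
have H3 : 0 <= 1 - ((k%:R + 1) ^+ 2)^-1 :> R.
  by rewrite subr_ge0 invf_le1 ?exprn_ge1 ?exprn_gt0; nra.
apply/eqP; rewrite -(@eqrXn2 _ 2) //; first last.
- by rewrite mulr_ge0 ?invr_ge0 ?sqrtr_ge0.
- by rewrite !mulr_ge0 ?invr_ge0 ?sqrtr_ge0 //; lra.
rewrite !exprMn !exprVn !sqr_sqrtr //.
by apply/eqP; field; rewrite k1 k2 kn.
Qed.

Let ratio' k : (0 < k)%N ->
  (Num.sqrt (k * k.+1)%:R)^-1 * (k%:R / k.+1%:R)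
   = Num.sqrt (1 - (k.+1%:R ^+ 2)^-1) * (Num.sqrt (k.+1 * k.+2)%:R)^-1 :> R.
Proof.
move=> k0; have kR : 0 < k%:R :> R by rewrite ltr0n.
have k1 : k%:R + 1 != 0 :> R by lra.
have k2 : k%:R + 1 + 1 != 0 :> R by lra.
have kn : k%:R != 0 :> R by lra.
rewrite !natrM -[k.+2%:R]natr1 -[k.+1%:R]natr1.
have H1 : 0 <= (k%:R + 1) * (k%:R + 1 + 1) :> R by nra.
have H2 : 0 <= k%:R * (k%:R + 1) :> R by nra.
have H3 : 0 <= 1 - ((k%:R + 1) ^+ 2)^-1 :> R.
  by rewrite subr_ge0 invf_le1 ?exprn_ge1 ?exprn_gt0; nra.
apply/eqP; rewrite -(@eqrXn2 _ 2) //; first last.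
- by rewrite mulr_ge0 ?invr_ge0 ?sqrtr_ge0.
- by rewrite !mulr_ge0 ?invr_ge0 ?sqrtr_ge0 //; lra.
rewrite !exprMn !exprVn !sqr_sqrtr //.
by apply/eqP; field; rewrite k1 k2 kn.
Qed.

Let t_out n (i j l : 'I_n) (b : nat) : j = i.+1 :> nat -> b != i -> b != j ->
  t b (tperm i j l) = t b l.
Proof.
move=> ji bi bj; rewrite /t; congr (_ * _); rewrite /u.
have e1 : (i < b)%N = (j < b)%N by lia.
have e2 : (i == b :> nat)%N = false by lia.
have e3 : (j == b :> nat)%N = false by lia.
by case: tpermP => [->|->|//]; rewrite e1 e2 e3.
Qed.

Let t_hi n (i j l : 'I_n) k : (0 < k)%N -> i = k :> nat -> j = k.+1 :> nat ->
  t k.+1 (tperm i j l) =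
    - (k.+1%:R)^-1 * t k.+1 l + Num.sqrt (1 - (k.+1%:R ^+ 2)^-1) * t k l.
Proof.
move=> k0 ik jk; rewrite /t (mulrA (Num.sqrt (1 - _))) -(ratio k0).
have f1 : (k.+1 < k)%N = false by lia.
have f2 : (k.+1 == k)%N = false by lia.
have f3 : (k == k.+1)%N = false by lia.
have k1 : k%:R + 1 != 0 :> R by rewrite natr1 pnatr_eq0.
set c := _^-1; have -> : u k.+1 (tperm i j l) =
   - k.+1%:R^-1 * u k.+1 l + (k.+2%:R / k.+1%:R) * u k l; last by ring.
rewrite /u -[k.+2%:R]natr1 -[k.+1%:R]natr1.
case: tpermP => [->|->|/eqP + /eqP +].
- rewrite ?ik ?jk ?ltnn ?ltnSn ?f1 ?f2 ?f3 ?eqxx. field; exact: k1.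
- rewrite ?ik ?jk ?ltnn ?ltnSn ?f1 ?f2 ?f3 ?eqxx. field; exact: k1.
- rewrite -!val_eqE /= ik jk => li lj.
  case: (ltngtP l k) => lk; last by rewrite lk eqxx in li.
    by rewrite ltnS (ltnW lk); field; exact: k1.
  have -> : (l < k.+1)%N = false by lia.
  by rewrite (negbTE lj); ring.
Qed.

Let t_lo n (i j l : 'I_n) k : (0 < k)%N -> i = k :> nat -> j = k.+1 :> nat ->
  t k (tperm i j l) =
    Num.sqrt (1 - (k.+1%:R ^+ 2)^-1) * t k.+1 l + (k.+1%:R)^-1 * t k l.
Proof.
move=> k0 ik jk; rewrite /t (mulrA (Num.sqrt (1 - _))) -(ratio' k0).
have f1 : (k.+1 < k)%N = false by lia.
have f2 : (k.+1 == k)%N = false by lia.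
have f3 : (k == k.+1)%N = false by lia.
have k1 : k%:R + 1 != 0 :> R by rewrite natr1 pnatr_eq0.
set c := _^-1; have -> : u k (tperm i j l) =
   (k%:R / k.+1%:R) * u k.+1 l + k.+1%:R^-1 * u k l; last by ring.
rewrite /u -[k.+1%:R]natr1.
case: tpermP => [->|->|/eqP + /eqP +].
- rewrite ?ik ?jk ?ltnn ?ltnSn ?f1 ?f2 ?f3 ?eqxx. field; exact: k1.
- rewrite ?ik ?jk ?ltnn ?ltnSn ?f1 ?f2 ?f3 ?eqxx. field; exact: k1.
- rewrite -!val_eqE /= ik jk => li lj.
  case: (ltngtP l k) => lk; last by rewrite lk eqxx in li.
    by rewrite ltnS (ltnW lk); field; exact: k1.
  have -> : (l < k.+1)%N = false by lia.
  by rewrite (negbTE lj); ring.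
Qed.

Let comb n (p q : R) (f g h r : 'I_n -> R) : (forall l, f l = p * g l + q * h l) ->
  \sum_l f l * r l = p * (\sum_l g l * r l) + q * (\sum_l h l * r l).
Proof.
move=> e; rewrite !mulr_sumr -big_split /=; apply: eq_bigr => l _.
by rewrite e; ring.
Qed.

Let E_gen n (i j : 'I_n.+2) : j = i.+1 :> nat -> E (tperm i j) = young_gen R n.+2 j.
Proof.
move=> ji; apply/matrixP => a b; rewrite !mxE.
have ha := ltn_ord a; have hb := ltn_ord b; have hj := ltn_ord j.
have st c d : (0 < c < n.+2)%N -> (0 < d < n.+2)%N ->
  \sum_(j < n.+2) t c j * t d j = (c == d)%:R by apply: sum_tt.
rewrite /young_gen; case: eqP => [j1|/eqP j1].
- have i0 : i = 0%N :> nat by lia.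
  rewrite !mxE /=; have [an|an] := eqVneq (a : nat) n.
  + have h l : t (n.+1 - a) (tperm i j l) = - t 1 l.
      rewrite an subSnn /t /u -mulrN; congr (_ * _).
      case: tpermP => [->|->|/eqP + /eqP +]; rewrite ?i0 ?j1 ?opprK //=.
      rewrite -!val_eqE /= i0 j1 => li lj.
      have -> : (l < 1)%N = false by lia.
      by rewrite (negbTE lj) oppr0.
    under eq_bigr do rewrite h mulNr.
    rewrite sumrN st; [|lia|lia].
    by rewrite -mulNrn; congr (_ *+ _); rewrite -val_eqE /=; lia.
  + have h l : t (n.+1 - a) (tperm i j l) = t (n.+1 - a) l by apply: t_out => //; lia.
    under eq_bigr do rewrite h.
    rewrite st; [|lia|lia].
    by congr (_ *+ _); rewrite -val_eqE /=; lia.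
- have [k k0 ik] : exists2 k, (0 < k)%N & i = k :> nat by exists i; lia.
  have jk : j = k.+1 :> nat by lia.
  rewrite !mxE jk.
  have [aa|aa] := eqVneq (n.+1 - a)%N k.+1.
    rewrite aa (comb _ (fun l => t_hi l k0 ik jk)) !st; [|lia..].
    have -> : (a == n.+2 - k.+2 :> nat)%N by lia.
    have -> : (a == (n.+2 - k.+2).+1 :> nat)%N = false by lia.
    rewrite /=.
    have [bb|bb] := eqVneq (b : nat) (n.+2 - k.+2)%N.
      have -> : (k.+1 == n.+1 - b)%N by lia.
      have -> : (k == n.+1 - b)%N = false by lia.
      by rewrite mulr0 addr0 mulr1.
    have -> : (k.+1 == n.+1 - b)%N = false by lia.
    have -> : (k == n.+1 - b)%N = (b == (n.+2 - k.+2).+1 :> nat)%N by lia.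
    rewrite orbF mulr0 add0r; case: ifP => _; first by rewrite mulr1.
    by rewrite mulr0; suff -> : (a == b) = false by []; rewrite -val_eqE /=; lia.
  have [aa'|aa'] := eqVneq (n.+1 - a)%N k.
    rewrite aa' (comb _ (fun l => t_lo l k0 ik jk)) !st; [|lia..].
    have -> : (a == n.+2 - k.+2 :> nat)%N = false by lia.
    have -> : (a == (n.+2 - k.+2).+1 :> nat)%N by lia.
    rewrite /=.
    have [bb|bb] := eqVneq (b : nat) (n.+2 - k.+2).+1.
      have -> : (k == n.+1 - b)%N by lia.
      have -> : (k.+1 == n.+1 - b)%N = false by lia.
      by rewrite mulr0 add0r mulr1.
    have -> : (k == n.+1 - b)%N = false by lia.
    have -> : (k.+1 == n.+1 - b)%N = (b == (n.+2 - k.+2) :> nat)%N by lia.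
    rewrite mulr0 addr0; case: ifP => _; first by rewrite mulr1.
    by rewrite mulr0; suff -> : (a == b) = false by []; rewrite -val_eqE /=; lia.
  have h l : t (n.+1 - a) (tperm i j l) = t (n.+1 - a) l by apply: t_out => //; lia.
    under eq_bigr do rewrite h.
  rewrite st; [|lia|lia].
  have -> : (a == n.+2 - k.+2 :> nat)%N = false by lia.
  have -> : (a == (n.+2 - k.+2).+1 :> nat)%N = false by lia.
  by rewrite /=; congr (_%:R); rewrite -val_eqE /=; lia.
Qed.

(* The Coxeter relations are not checked directly: D s is the restriction of
   T P_s T^t, P_s a permutation matrix, to the last n - 1 coordinates. *)
Lemma is_Dphi_exists n : (1 < n)%N ->
  exists D : 'S_n -> 'M[R]_n.-1, is_Dphi D.
Proof.
case: n => [|[|n]] // _; exists (@E n); split=> [s d|s|i j ji].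
- exact: EM.
- by rewrite E_tr -EM mulgV E1.
- exact: E_gen.
Qed.

End Existence.

(* Main.v *)
Require Import Defs.
From mathcomp Require Import all_boot all_order all_algebra all_fingroup.
From mathcomp Require Import lra zify.
From mathcomp Require Import reals.
From mathcomp.real_closed Require Import complex.

Set Implicit Arguments.
Unset Strict Implicit.
Unset Printing Implicit Defensive.

Import Order.TTheory GRing.Theory Num.Theory.
Local Open Scope ring_scope.

(* Both transforms are diagonal multiples of U. For T this is the definition.
For F, fix a row m of D and let v(j) be the sum of the first columns of D(s)
over the permutations s with s(n) = j, so that D(t) v(j) = v(t j) and
F x = sum_j x(j) v(j). In zero-based indices put b = n - 1 - m. The row m of
D(tau_k) is trivial unless k is b or b + 1, so v(j)_m does not depend on j < b;
v(j) is fixed by tau_k for all k < j, which kills v(j)_m for j > b; and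
sum_j v(j) is fixed by the whole group, hence zero, which determines v(b)_m.
These three properties say that v(.)_m is a multiple of row m + 1 of U.

Row n - b of U x is b x_b - (x_0 + ... + x_(b-1)). All prefix sums cost n - 1
additions, and the rows another n - 1; the factors b > 1 cost n - 2
multiplications, and the diagonal scaling n. *)

(** * Straight-line programs and their operation counts *)

Section StraightLine.
Variables (C : nzRingType) (n : nat).
Implicit Types (p : seq (step C)) (g h : 'cV[C]_n -> C).
Implicit Types G : ('cV[C]_n -> C) -> Prop.

Definition entries (x : 'cV[C]_n) : seq C := [seq x j 0 | j <- enum 'I_n].

Lemma size_entries x : size (entries x) = n.
Proof. by rewrite size_map size_enum_ord. Qed.

Lemma nth_entries x (j : 'I_n) : (entries x)`_j = x j 0.
Proof.
by rewrite (nth_map j) ?size_enum_ord // nth_ord_enum.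
Qed.

Lemma size_run (v : seq C) p : size (run v p) = (size v + size p)%N.
Proof.
by elim: p v => [|s p IH] v /=; rewrite ?addn0 // IH size_rcons addSnnS.
Qed.

Lemma run_rcons (v : seq C) p s :
  run v (rcons p s) = rcons (run v p) (step_val (run v p) s).
Proof. by rewrite /run foldl_rcons. Qed.

Lemma prog_ok_rcons m p (s : step C) :
  prog_ok m (rcons p s) = prog_ok m p && step_ok (m + size p) s.
Proof.
by elim: p m => [|s' p IH] m /=; rewrite ?andbT ?addn0 // IH addSnnS andbA.
Qed.

Definition available p g :=
  exists2 i, (i < n + size p)%N & forall x, (run (entries x) p)`_i = g x.

(** [G] is a set of functions of the input, all read off one and the same program. Intermediate
    results can thus be shared, and a program can grow step by step while earlier results stay in
    reach. *)
Definition computes m a G := exists p,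
  [/\ prog_ok n p, count (@is_mul C) p = m, count (@is_add C) p = a
    & forall g, G g -> available p g].

Lemma available_rcons p s g : available p g -> available (rcons p s) g.
Proof.
case=> i ip ig; exists i; first by rewrite size_rcons addnS leqW.
by move=> x; rewrite run_rcons nth_rcons size_run size_entries ip.
Qed.

Lemma available_last p s g :
  (forall x, step_val (run (entries x) p) s = g x) -> available (rcons p s) g.
Proof.
move=> sg; exists (n + size p)%N; first by rewrite size_rcons addnS.
by move=> x; rewrite run_rcons nth_rcons size_run size_entries ltnn eqxx.
Qed.

Lemma computes0 : computes 0 0 (fun g => exists j, forall x, g x = x j 0).
Proof.
exists [::]; split=> // g [j gj]; exists (j : nat); first by rewrite addn0.
by move=> x; rewrite gj /= nth_entries.
Qed.

Lemma computes_weaken m a G G' : (forall g, G' g -> G g) ->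
  computes m a G -> computes m a G'.
Proof. by move=> sG [p [? ? ? pG]]; exists p; split=> // g /sG/pG. Qed.

Lemma computes_mul m a G c g : G g -> computes m a G ->
  computes m.+1 a (fun h => G h \/ forall x, h x = c * g x).
Proof.
move=> Gg [p [pok pm pa pG]]; have [i ip ig] := pG g Gg.
exists (rcons p (Mul c i)); split.
- by rewrite prog_ok_rcons pok.
- by rewrite -cats1 count_cat pm /= addn0 addn1.
- by rewrite -cats1 count_cat pa /is_add /= !addn0.
- move=> h [/pG|hE]; first exact: available_rcons.
  apply: available_last => x /=.
  by rewrite ig hE.
Qed.

Lemma computes_add m a G g1 g2 : G g1 -> G g2 -> computes m a G ->
  computes m a.+1 (fun h => G h \/ forall x, h x = g1 x + g2 x).
Proof.
move=> Gg1 Gg2 [p [pok pm pa pG]].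
have [i ip ig] := pG _ Gg1; have [j jp jg] := pG _ Gg2.
exists (rcons p (Add C i j)); split.
- by rewrite prog_ok_rcons pok /= ip jp.
- by rewrite -cats1 count_cat pm /= !addn0.
- by rewrite -cats1 count_cat pa /is_add /= addn0 addn1.
- move=> h [/pG|hE]; first exact: available_rcons.
  apply: available_last => x /=.
  by rewrite ig jg hE.
Qed.

Lemma computes_sub m a G g1 g2 : G g1 -> G g2 -> computes m a G ->
  computes m a.+1 (fun h => G h \/ forall x, h x = g1 x - g2 x).
Proof.
move=> Gg1 Gg2 [p [pok pm pa pG]].
have [i ip ig] := pG _ Gg1; have [j jp jg] := pG _ Gg2.
exists (rcons p (Defs.Sub C i j)); split.
- by rewrite prog_ok_rcons pok /= ip jp.
- by rewrite -cats1 count_cat pm /= !addn0.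
- by rewrite -cats1 count_cat pa /is_add /= addn0 addn1.
- move=> h [/pG|hE]; first exact: available_rcons.
  apply: available_last => x /=.
  by rewrite ig jg hE.
Qed.

Lemma computes_computable (f : 'cV[C]_n -> 'cV[C]_n) m a G :
    (forall i, G (fun x => f x i 0)) -> computes m a G ->
  computable_with f m a.
Proof.
move=> Gf [p [pok pm pa pG]].
have /fin_all_exists2[out outp outf] := fun i => pG _ (Gf i).
by exists p, out; split=> // x i; exact: outf.
Qed.

(** * Sharing prefix sums between the rows of U *)

Definition prefix_sum k (x : 'cV[C]_n) : C := \sum_(j < n | (j < k)%N) x j 0.

Lemma prefix_sumS (k : 'I_n) x : prefix_sum k.+1 x = prefix_sum k x + x k 0.
Proof.
rewrite /prefix_sum (bigD1 k) //= addrC; congr (_ + _).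
by apply: eq_bigl => j; rewrite -val_eqE /=; lia.
Qed.

Definition helmert_row (i : 'I_n) (x : 'cV[C]_n) : C := i%:R * x i 0 - prefix_sum i x.

(** Invariant of the induction that builds the program. Only the latest prefix sum is kept: it
    serves the next row and the next prefix sum. The rows carry their factor [c] from the start, so
    the diagonal scaling is already counted. *)
Definition prefix_forms (c : 'I_n -> C) k g : Prop :=
  [\/ exists j, forall x, g x = x j 0,
      forall x, g x = prefix_sum k.+1 x
    | exists2 i : 'I_n, (0 < i <= k)%N & forall x, g x = c i * helmert_row i x].

(** The first row costs one multiplication and two additions; each later one costs two of each. *)
Lemma computes_prefix_forms (c : 'I_n -> C) k : (k.+1 < n)%N ->
  computes k.*2.+1 k.+1.*2 (prefix_forms c k.+1).
Proof.
elim: k => [|k IH] kn.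
  pose i0 : 'I_n := Ordinal (ltnW kn); pose i1 : 'I_n := Ordinal kn.
  have ps1 x : prefix_sum 1 x = x i0 0.
    by rewrite (prefix_sumS i0) /prefix_sum big_pred0 ?add0r.
  (* The row x_1 - x_0 has factor b = 1, so only [c i1] costs a multiplication; the first prefix sum
     is x_0 itself and is free. *)
  have H := @computes_sub _ _ _ (fun x => x i1 0) (fun x => x i0 0)
    (ex_intro _ i1 (fun=> erefl)) (ex_intro _ i0 (fun=> erefl)) computes0.
  have {}H := computes_mul (c i1) (or_intror (fun=> erefl)) H.
  have {}H := @computes_add _ _ _ (fun x => x i0 0) (fun x => x i1 0)
    (or_introl (or_introl (ex_intro _ i0 (fun=> erefl))))
    (or_introl (or_introl (ex_intro _ i1 (fun=> erefl)))) H.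
  apply: computes_weaken H => g [gE|gE|[i i_1 gE]].
  - by do 3 left.
  - by right => x; rewrite gE (prefix_sumS i1) ps1.
  - left; right => x; have -> : i1 = i by apply/val_inj => /=; lia.
    rewrite gE /helmert_row; have -> : i = i1 by apply/val_inj => /=; lia.
    by rewrite ps1 mul1r.
pose i : 'I_n := Ordinal kn.
have H := IH (ltnW kn).
have Gi : prefix_forms c k.+1 (fun x => x i 0) by apply: Or31; exists i.
have Gs : prefix_forms c k.+1 (prefix_sum k.+2) by apply: Or32.
(* Four steps, with i = k + 2: form i x_i, subtract the prefix sum, scale by [c i], then extend the
   prefix sum by x_i. *)
have {}H := computes_mul i%:R Gi H.
have {}H := computes_sub (or_intror (fun=> erefl)) (or_introl Gs) H.
have {}H := computes_mul (c i) (or_intror (fun=> erefl)) H.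
have {}H := computes_add (or_introl (or_introl (or_introl Gs)))
  (or_introl (or_introl (or_introl Gi))) H.
apply: computes_weaken H => g [gE|gE|[j jk gE]].
- by do 4 left; apply: Or31.
- by right => x; rewrite gE (prefix_sumS i).
- have [ji|ji] := eqVneq j i.
    by left; right => x; rewrite gE ji.
  do 4 left; apply: Or33; exists j => //.
  by move: ji; rewrite -val_eqE /=; lia.
Qed.

End StraightLine.

(** * Computing a diagonal multiple of U *)

Section ScaledU.
Variables (R : realType) (n : nat).
Implicit Type x : 'cV[R[i]]_n.

Let Ux x := map_mx (real_complex R) (Umx R n) *m x.

Lemma Umx_mul_row0 (i : 'I_n) x : i = 0%N :> nat -> Ux x i 0 = prefix_sum n x.
Proof.
move=> i0; rewrite mxE; apply: eq_big => j; first by rewrite ltn_ord.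
by move=> _; rewrite !mxE i0 /= rmorph1 mul1r.
Qed.

Lemma Umx_mul_row (i b : 'I_n) x : (0 < i)%N -> b = (n - i)%N :> nat ->
  Ux x i 0 = helmert_row b x.
Proof.
move=> i0 bi; rewrite mxE /helmert_row /prefix_sum (bigD1 b) //= !mxE -bi.
have -> : (i == 0%N :> nat) = false by lia.
rewrite ltnn eqxx rmorph_nat; congr (_ + _).
rewrite -sumrN (bigID (fun j : 'I_n => (j < b)%N)) /= [X in _ + X]big1 ?addr0.
  apply: eq_big => j; first by rewrite -val_eqE /=; lia.
  case/andP=> _ jb; rewrite !mxE -bi jb.
  have -> : (i == 0%N :> nat) = false by lia.
  by rewrite rmorphN1 mulN1r.
move=> j /andP[]; rewrite -val_eqE /= => /negbTE jb /negbTE jlb.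
rewrite !mxE -bi jb jlb.
have -> : (i == 0%N :> nat) = false by lia.
by rewrite rmorph0 mul0r.
Qed.

Lemma computable_scaled_Umx (c : 'I_n -> R[i]) (f : 'cV[R[i]]_n -> 'cV[R[i]]_n) :
    (1 < n)%N -> (forall x i, f x i 0 = c i * Ux x i 0) ->
  computable_with f (2 * n - 2) (2 * n - 2).
Proof.
move=> n1 fE.
have n0 : (0 < n)%N by exact: ltnW.
(* For b > 0 this index is n - b, the row of U that holds b on its staircase; the detour through
   [b.-1.+1] keeps it below n at b = 0. *)
have flip_lt (b : 'I_n) : (n - b.-1.+1 < n)%N by lia.
pose flip b := Ordinal (flip_lt b).
have [k kn] : exists k, n = k.+2 by exists n.-2; lia.
have H := @computes_prefix_forms R[i] n (fun b => c (flip b)) k.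
(* As n = k + 2, the last prefix sum is the sum of all entries, that is row 0; scaling it is the
   multiplication that brings 2k + 1 up to 2n - 2. *)
have {}H := computes_mul (c (Ordinal n0)) (Or32 _ _ (fun=> erefl)) (H _).
have -> : (2 * n - 2)%N = k.+1.*2 by lia.
apply: computes_computable (H _); last by rewrite kn.
move=> i; have [i0|i0] := eqVneq (i : nat) 0%N.
  right => x; rewrite fE Umx_mul_row0 // -kn; congr (c _ * _).
  exact/val_inj.
have bn : (n - i < n)%N by lia.
left; apply: Or33; exists (Ordinal bn) => [/=|x]; first by have := ltn_ord i; lia.
rewrite fE (@Umx_mul_row i (Ordinal bn)) //; last by rewrite lt0n.
by congr (c _ * _); apply/val_inj => /=; have := ltn_ord i; lia.
Qed.

End ScaledU.

(** * Sums of a representation over the permutations with a given value at a point *)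

Section Fibers.
Variables (R : realType) (n d : nat) (D : 'S_n -> 'M[R]_d).
Variables (p : 'I_n) (q : 'I_d).
Hypothesis DM : forall s t : 'S_n, D (t * s)%g = D s *m D t.

Definition fiber_sum (j : 'I_n) : 'cV[R]_d := \sum_(s : 'S_n | s p == j) col q (D s).

(** Composing with t on the outside, written [s * t] here, carries the permutations sending p to j
    bijectively onto those sending p to t j. *)
Lemma fiber_sum_perm (t : 'S_n) j : D t *m fiber_sum j = fiber_sum (t j).
Proof.
rewrite /fiber_sum mulmx_sumr [RHS](reindex_inj (mulIg t)) /=.
apply: eq_big => s; first by rewrite permM (inj_eq perm_inj).
by move=> _; rewrite DM !colE mulmxA.
Qed.

Lemma sum_fiber_sum_perm (t : 'S_n) :
  D t *m (\sum_j fiber_sum j) = \sum_j fiber_sum j.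
Proof.
rewrite mulmx_sumr [RHS](reindex_inj (@perm_inj _ t)) /=.
by apply: eq_bigr => j _; rewrite fiber_sum_perm.
Qed.

End Fibers.

(** * Rows of the fiber sums in the Young orthogonal form *)

Section YoungRepresentation.
Variable R : realType.

(** Each further generator kills one more coordinate, from the bottom up: tau_1 negates the last
    one, and the upper row of R_k then acts by -1/k, since the coordinate below it already
    vanishes. *)
Lemma young_gen_fixed n (w : 'cV[R]_n.-1) K : (K < n)%N ->
    (forall k, (0 < k <= K)%N -> young_gen R n k *m w = w) ->
  forall a : 'I_n.-1, (n.-1 - K <= a)%N -> w a 0 = 0.
Proof.
elim: K => [|K IH] Kn fixw a aK.
  by have := ltn_ord a; lia.
have {IH} w0 (b : 'I_n.-1) : (n.-1 - K <= b)%N -> w b 0 = 0.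
  by apply: IH => [|k kK]; [exact: ltnW | apply: fixw; lia].
have [ha|ha] := leqP (n.-1 - K)%N a; first exact: w0.
have /matrixP/(_ a 0) := fixw K.+1 (leqnn _).
rewrite /young_gen; case: eqP => [K0|/eqP K0].
  rewrite mul_diag_mx !mxE.
  have -> : (a == n.-2 :> nat) by lia.
  by move=> waN; lra.
have aE : (a == n - K.+2 :> nat)%N by lia.
have aE' : (a == (n - K.+2).+1 :> nat)%N = false by lia.
(* Off the diagonal, row a meets only zero matrix entries or coordinates of w already known to
   vanish, leaving w_a = - w_a / (K + 1). *)
rewrite mxE (bigD1 a) //= big1 ?addr0 => [|b ba].
  rewrite !mxE aE /= => waN.
  have k0 : 0 < (K.+1%:R)^-1 :> R by rewrite invr_gt0 ltr0n.
  have /eqP : (1 + (K.+1%:R)^-1) * w a 0 = 0.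
    by rewrite mulrDl mul1r -{1}waN mulNr addNr.
  by rewrite mulf_eq0 gt_eqF ?addr_gt0 // => /eqP.
have [ltab|leba] := ltnP a b; first by rewrite w0 ?mulr0 //; lia.
move: ba; rewrite -val_eqE /= => ba.
rewrite mxE aE aE' /=.
have -> : (b == n - K.+2 :> nat)%N = false by lia.
have -> : (b == (n - K.+2).+1 :> nat)%N = false by lia.
suff -> : (a == b) = false by rewrite mul0r.
by rewrite -val_eqE /=; lia.
Qed.

(** The two inequalities keep m away from rows n - k and n - k - 1, the only ones where tau_k can
    differ from the identity. *)
Lemma young_gen_mul_row n (w : 'cV[R]_n.-1) k (m : 'I_n.-1) :
    (0 < k < n)%N -> (k + m)%N != n -> (k + m).+1 != n ->
  (young_gen R n k *m w) m 0 = w m 0.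
Proof.
move=> /andP[k0 kn] m1 m2; have mn := ltn_ord m.
rewrite /young_gen; case: eqP => [k1|/eqP k1].
  rewrite mul_diag_mx !mxE.
  have -> : (m == n.-2 :> nat) = false by lia.
  by rewrite mul1r.
have ma : (m == n - k.+1 :> nat)%N = false by lia.
have ma' : (m == (n - k.+1).+1 :> nat)%N = false by lia.
rewrite mxE (bigD1 m) //= big1 ?addr0 => [|j /negbTE jm].
  by rewrite mxE ma ma' /= eqxx mul1r.
by rewrite mxE ma ma' /= eq_sym jm mul0r.
Qed.

Variables (n : nat) (D : 'S_n -> 'M[R]_n.-1).
Variables (p : 'I_n) (q : 'I_n.-1).
Hypothesis D_Young : is_Dphi D.

Let DM (s t : 'S_n) : D (t * s)%g = D s *m D t.
Proof. by case: D_Young => + _ _; apply. Qed.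

Let v := fiber_sum D p q.

Let v_perm (t : 'S_n) j : D t *m v j = v (t j).
Proof. exact: fiber_sum_perm. Qed.

Let adj k : (0 < k < n)%N -> exists i j : 'I_n,
  [/\ i.+1 = k, j = k :> nat & D (tperm i j) = young_gen R n k].
Proof.
case: D_Young => _ _ Dgen /andP[k0 kn].
have kn' : (k.-1 < n)%N by lia.
exists (Ordinal kn'), (Ordinal kn); split=> //=; first by lia.
by rewrite Dgen //= prednK.
Qed.

Let v_hi (m : 'I_n.-1) (j : 'I_n) : (n <= m + j)%N -> v j m 0 = 0.
Proof.
move=> mj; apply: (@young_gen_fixed n (v j) j.-1).
- by have := ltn_ord j; lia.
- move=> k kj; have kn : (0 < k < n)%N by have := ltn_ord j; lia.
  have [a [b [ak bk <-]]] := adj kn.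
  by rewrite v_perm tpermD // -val_eqE /=; lia.
- by have := ltn_ord j; lia.
Qed.

Let v_lo (m : 'I_n.-1) (o j : 'I_n) : o = 0%N :> nat -> (m + j < n.-1)%N ->
  v j m 0 = v o m 0.
Proof.
move=> o0; case: j => j; elim: j => [|j IH] jn mj /=.
  by have -> : Ordinal jn = o by apply/val_inj; rewrite /= o0.
(* The transposition of j and j + 1 carries [v j] to [v (j + 1)] and leaves row m unchanged, because
   m + j + 1 < n - 1. *)
have [a [b [aj bj Dab]]] := adj (k := j.+1) jn.
rewrite -(IH (ltnW jn)) /=; last by move: mj => /=; lia.
have <- : tperm a b (Ordinal (ltnW jn)) = Ordinal jn.
  have -> : Ordinal (ltnW jn) = a by apply/val_inj => /=; lia.
  by rewrite tpermL; apply/val_inj.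
move: mj => /= mj.
by rewrite -v_perm Dab young_gen_mul_row //; lia.
Qed.

Let v_sum (m : 'I_n.-1) : \sum_j v j m 0 = 0.
Proof.
(* With K = n - 1 every coordinate is covered: a vector fixed by all the generators is zero. *)
rewrite -summxE; apply: (@young_gen_fixed n _ n.-1); last 2 first.
- move=> k kj; have kn : (0 < k < n)%N by lia.
  by have [a [b [_ _ <-]]] := adj kn; rewrite sum_fiber_sum_perm.
- by rewrite subnn.
- by have := ltn_ord m; lia.
Qed.

Lemma fiber_sum_Umx (m : 'I_n.-1) (i : 'I_n) : i = m.+1 :> nat ->
  exists c : R, forall j, v j m 0 = c * Umx R n i j.
Proof.
move=> im; have mn := ltn_ord m; have ii := ltn_ord i.
have n0 : (0 < n)%N by lia.
have bn : (n - i < n)%N by lia.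
pose o := Ordinal n0; pose b := Ordinal bn.
have vlo (j : 'I_n) : (j < b)%N -> v j m 0 = v o m 0.
  by move=> jb; apply: v_lo => //; move: jb => /=; lia.
have vhi (j : 'I_n) : (b < j)%N -> v j m 0 = 0.
  by move=> jb; apply: v_hi => //; move: jb => /=; lia.
(* In the vanishing total, the b = n - i values before b all equal [v o m 0] and those after b are
   zero. *)
have vb : v b m 0 = - ((n - i)%:R * v o m 0).
  apply/eqP; rewrite -addr_eq0 -(v_sum m) (bigD1 b) //=; apply/eqP.
  congr (_ + _); rewrite (bigID (fun j : 'I_n => (j < b)%N)) /=.
  rewrite [X in _ + X]big1 ?addr0 => [|j /andP[]]; last first.
    by rewrite -val_eqE /= => jb jlb; rewrite vhi //=; lia.
  rewrite (eq_big (fun j : 'I_n => (j < n - i)%N) (fun=> v o m 0)); first last.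
  - by move=> j /andP[_ /vlo].
  - by move=> j; rewrite -val_eqE /=; lia.
  rewrite -(big_ord_widen n (fun=> v o m 0) (ltnW bn)).
  by rewrite sumr_const card_ord mulr_natl.
(* The row of U starts with -1, hence the sign. *)
exists (- v o m 0) => j; rewrite mxE im /= -im.
case: ltngtP => [jb|bj|jb].
- by rewrite vlo // mulrN1 opprK.
- by rewrite vhi // mulr0.
- have -> : j = b by apply/val_inj.
  by rewrite vb mulNr mulrC.
Qed.

End YoungRepresentation.

(** * The Fourier transform as a diagonal multiple of U, and the conclusion *)

(** The sum over the group is partitioned by the image of the last point, on which alone the weight
    x(s(n)) depends. *)
Lemma ftransformE (R : realType) n (hn : (1 < n)%N) d (D : 'S_n -> 'M[R]_d)
    (x : 'cV[R[i]]_n) (m q : 'I_d) :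
  ftransform hn D x m q =
    \sum_j real_complex R (fiber_sum D (last_pt hn) q j m 0) * x j 0.
Proof.
rewrite /ftransform summxE.
rewrite (partition_big (fun s : 'S_n => s (last_pt hn)) predT) //=.
apply: eq_bigr => j _; rewrite summxE rmorph_sum mulr_suml.
by apply: eq_bigr => s /eqP sj; rewrite !mxE sj mulrC.
Qed.

Lemma fourier_Umx (R : realType) n (hn : (1 < n)%N) (D : 'S_n -> 'M[R]_n.-1) :
    is_Dphi D -> forall i : 'I_n, exists c : R[i], forall x,
  fourier hn D x i 0 = c * (map_mx (real_complex R) (Umx R n) *m x) i 0.
Proof.
move=> DY i; rewrite /fourier.
have castE (A : 'cV[R[i]]_(1 + n.-1)) :
    castmx (add1_pred hn, erefl 1%N) A i 0 = A (cast_ord (esym (add1_pred hn)) i) 0.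
  by rewrite castmxE; congr (A _ _); apply/val_inj.
have [i0|i0] := posnP i.
  pose v := fiber_sum (@Dtriv R n) (last_pt hn) 0.
  exists (real_complex R (v i 0 0)) => x; rewrite castE.
  have -> : cast_ord (esym (add1_pred hn)) i = lshift n.-1 0 by apply/val_inj.
  rewrite col_mxEu ftransformE mxE mulr_sumr; apply: eq_bigr => j _.
  rewrite mxE [in RHS]mxE i0 /= rmorph1 mul1r; congr (real_complex R _ * _).
  (* The transposition of i and j carries one fiber sum to the other and acts trivially, so all
     fiber sums of the trivial representation agree, like the entries of row 0 of U. *)
  rewrite -[in LHS](tpermL i j) -[in LHS]fiber_sum_perm ?mul1mx // => s t.
  by rewrite mul1mx.
have mn : (i.-1 < n.-1)%N by have := ltn_ord i; lia.
pose m := Ordinal mn.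
have im : i = m.+1 :> nat by rewrite /= prednK.
have [c vc] := fiber_sum_Umx (last_pt hn) (first_col hn) DY im.
exists (real_complex R c) => x; rewrite castE.
have -> : cast_ord (esym (add1_pred hn)) i = rshift 1 m.
  by apply/val_inj => /=; rewrite add1n prednK.
rewrite col_mxEd mxE ftransformE [in RHS]mxE mulr_sumr; apply: eq_bigr => j _.
by rewrite vc rmorphM [in RHS]mxE mulrA.
Qed.

Theorem mainTheorem3 (R : realType) (n : nat) (hn : (1 < n)%N) :
  computable_with (fun x : 'cV[R[i]]_n => map_mx (real_complex R) (Tmx R n) *m x)
    (2 * n - 2) (2 * n - 2)
  /\ (forall D : 'S_n -> 'M[R]_n.-1, is_Dphi D ->
        computable_with (fourier hn D) (2 * n - 2) (2 * n - 2)).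
Proof.
split=> [|D DY].
  apply: (computable_scaled_Umx (c := fun i => real_complex R (Amx R n i i))) => // x i.
  rewrite /Tmx map_mxM -mulmxA /Amx map_diag_mx mul_diag_mx !mxE.
  by rewrite eqxx mulr1n.
(* The factors are chosen row by row before x is given, so they are legitimate program constants. *)
have /fin_all_exists[c cE] := fourier_Umx hn DY.
by apply: (computable_scaled_Umx (c := c)) => // x i; rewrite cE.
Qed.
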